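(* Let $A_1,A_2\subset\mathbf{R}^3$ be arcs contained in perpendicular planes, with parameterizations $\gamma_1,\gamma_2$, and suppose the distance function $\rho(s,t)$ of $\gamma_1,\gamma_2$ is of a special form. Then there exist nonempty open subsets $A_1'\subset A_1$, $A_2'\subset A_2$ that are contained (one in each set) in one of the following pairs of sets: (i) a line $\ell$ and a curve contained in a plane orthogonal to $\ell$; (ii) two parallel lines; (iii) a line $\ell$ and an ellipse contained in a cylinder centered around $\ell$; (iv) CPO parabolas; (v) matching curves; (vi) matching log-circles.
   Context: An arc is a set $S\subset\mathbf{R}^3$ admitting a smooth bijective map $\gamma:(0,1)\to S$ (a parameterization); open subsets are relative to the arc. The distance function of $\gamma_1,\gamma_2$ is $\rho(s,t)=|\gamma_1(s)-\gamma_2(t)|^2$. A function $f$ of two variables is of a special form if there exist open intervals $I_1,I_2,I_3$ and smooth $\phi_i:I_i\to\mathbf{R}$ with $\phi_1(s)+\phi_2(t)\in I_3$ and $f(s,t)=\phi_3(\phi_1(s)+\phi_2(t))$ for all $s\in I_1,t\in I_2$. A curve is an irreducible one-dimensional real algebraic variety of constant complexity. A cylinder is a right circular cylinder; centered around $\ell$ means with axis $\ell$. Parabolas are CPO if one is obtained from the other by translation and rotation, they share the same axis (line through vertex and focus), their planes are perpendicular, and their vertex-to-focus vectors are opposite. For $a,m>0$, $b\neq0$, $m\ne1$, let $E_1=\{mx^2+y^2=a,z=0\}$, $E_2=\{\frac{m}{m-1}x^2+z^2=b,y=0\}$; two curves match if they are the image of $(E_1,E_2)$ under a rotation and translation. A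 log-circle is an image under rotation and translation of $\{(x,y,0):x^2+y^2=D+A\ln|x-B|\}$ for some $A,B,D\in\mathbf{R}$; two log-circles match if they are obtained by rotating, translating and scaling the pair $\{(x,y,0):(x-B)^2+y^2=D+A\ln|x|\}$, $\{(x,0,z):x^2+z^2=D'+A\ln|x-B|\}$ for some $A,B,D,D'\in\mathbf{R}$.
   Formalization: In (i), ''curve'' also allows any arc, since {(t,e^t,0)} with the z-axis refutes the algebraic reading; open subsets of an arc are images of open parameter sets, as subspace openness fails for arcs accumulating on themselves; parallel lines may coincide. *)

(* Defs.v *)
From HB Require Import structures.
From mathcomp Require Import all_boot all_order all_algebra.
From mathcomp Require Import all_classical all_reals all_analysis.
From mathcomp Require mpoly.

Set Implicit Arguments.
Unset Strict Implicit.
Unset Printing Implicit Defensive.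

Import Order.TTheory GRing.Theory Num.Theory.
Import numFieldNormedType.Exports.

Local Open Scope classical_set_scope.
Local Open Scope ring_scope.

Section Defs.
Variable R : realType.

Local Notation E3 := 'rV[R]_3.

(* The library norm on row vectors is the sup norm, so Euclidean notions are
   expressed through the dot product. *)
Definition dot (u v : E3) : R := (u *m v^T) 0 0.

Definition sqdist (p q : E3) : R := dot (p - q) (p - q).

Definition vec3 (x y z : R) : E3 := \row_(i < 3) [:: x; y; z]`_i.

(* For open D, the values on D of the iterated derivatives do not depend on the
   values of f outside D. *)
Definition smooth_on (V : normedModType R) (D : set R) (f : R -> V) : Prop :=
  forall (n : nat) (x : R), D x -> derivable (derive1n n f) x 1.

Definition open_interval (I : set R) : Prop :=
  [/\ open I, is_interval I & I !=set0].

Definition parameterization (g : R -> E3) (S : set E3) : Prop :=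
  smooth_on `]0, 1[ g /\ set_bij `]0, 1[ S g.

Definition arc (S : set E3) : Prop := exists g, parameterization g S.

(* Topology of the arc itself, carried by its parameterization.  It is the
   subspace topology when g is a homeomorphism onto its image.  The two differ
   when an end of the arc accumulates on the arc: then a subspace-open set
   meeting g(U) may always contain points far from U in the parameter, whereas
   a special form constrains g only on a subinterval. *)
Definition arc_open (g : R -> E3) (A' : set E3) : Prop :=
  exists U : set R, [/\ open U, U `<=` `]0, 1[ & A' = g @` U].

Definition distance_function (g1 g2 : R -> E3) : R -> R -> R :=
  fun s t => sqdist (g1 s) (g2 t).

(* f is a function on D1 x D2. *)
Definition special_form (D1 D2 : set R) (f : R -> R -> R) : Prop :=
  exists (I1 I2 I3 : set R) (phi1 phi2 phi3 : R -> R),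
    [/\ [/\ open_interval I1, open_interval I2 & open_interval I3],
        I1 `<=` D1 /\ I2 `<=` D2,
        [/\ smooth_on I1 phi1, smooth_on I2 phi2 & smooth_on I3 phi3] &
        forall s t, I1 s -> I2 t ->
          I3 (phi1 s + phi2 t) /\ f s t = phi3 (phi1 s + phi2 t)].

Definition plane (p n : E3) : set E3 := [set q | dot (q - p) n = 0].

Definition in_perpendicular_planes (S1 S2 : set E3) : Prop :=
  exists p1 n1 p2 n2 : E3,
    [/\ n1 != 0, n2 != 0, dot n1 n2 = 0, S1 `<=` plane p1 n1
      & S2 `<=` plane p2 n2].

Definition line (p u : E3) : set E3 :=
  [set q | exists t : R, q = p + t *: u].

Definition rigid_motion (g : E3 -> E3) : Prop :=
  exists (U : 'M[R]_3) (c : E3),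
    [/\ U *m U^T = 1%:M, \det U = 1 & forall v, g v = v *m U + c].

(* Algebraic curves *)

Definition variety (V : set E3) : Prop :=
  exists (k : nat) (p : 'I_k -> mpoly.mpoly 3 R),
    V = [set v | forall j, mpoly.meval (fun i : 'I_3 => v 0 i) (p j) = 0].

Definition irreducible_variety (V : set E3) : Prop :=
  [/\ variety V, V !=set0 &
      forall W1 W2, variety W1 -> variety W2 -> V = W1 `|` W2 ->
        V = W1 \/ V = W2].

(* Dimension one in the sense of Krull: there is a chain W < V of irreducible
   varieties, but no chain W < W' < V. *)
Definition algebraic_curve (V : set E3) : Prop :=
  [/\ irreducible_variety V,
      exists W, irreducible_variety W /\ W `<` V &
      forall W W', irreducible_variety W -> irreducible_variety W' ->
        W `<` W' -> ~ W' `<` V].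

(* Together with a line, every arc in an orthogonal plane gives a distance
   function of a special form, algebraic or not, such as {(t, e^t, 0)} with the
   z-axis.  A curve is therefore an algebraic curve or an arc. *)
Definition curve (S : set E3) : Prop := algebraic_curve S \/ arc S.

Definition line_and_orthogonal_curve (S1 S2 : set E3) : Prop :=
  exists p u q : E3,
    [/\ u != 0, S1 = line p u, curve S2 & S2 `<=` plane q u].

(* The lines may coincide: two arcs of one line lie in perpendicular planes and
   have distance function (s - t)^2. *)
Definition parallel_lines (S1 S2 : set E3) : Prop :=
  exists p q u : E3, [/\ u != 0, S1 = line p u & S2 = line q u].

Definition ellipse (S : set E3) : Prop :=
  exists (a b : R) (g : E3 -> E3),
    [/\ 0 < a, 0 < b, rigid_motion g &
        S = g @` [set v | exists x y, v = vec3 x y 0 /\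
                            (x / a) ^+ 2 + (y / b) ^+ 2 = 1]].

(* p + t *: u is the orthogonal projection of q on the axis. *)
Definition cylinder (p u : E3) (r : R) : set E3 :=
  [set q | exists t : R, dot (q - (p + t *: u)) u = 0 /\
                         sqdist q (p + t *: u) = r ^+ 2].

Definition line_and_cylinder_ellipse (S1 S2 : set E3) : Prop :=
  exists (p u : E3) (r : R),
    [/\ u != 0, 0 < r, S1 = line p u, ellipse S2 & S2 `<=` cylinder p u r].

(* The parabola with vertex v and focus v + w in the plane with normal n:
   the points of the plane at equal distance from the focus and from the
   directrix, which is orthogonal to w and passes through v - w. *)
Definition parabola (v w n : E3) : set E3 :=
  [set q | plane v n q /\
           sqdist q (v + w) * dot w w = dot (q - (v - w)) w ^+ 2].

Definition CPO_parabolas (S1 S2 : set E3) : Prop :=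
  exists v1 w1 n1 v2 w2 n2 : E3,
    [/\ [/\ w1 != 0, n1 != 0, dot w1 n1 = 0 & S1 = parabola v1 w1 n1],
        [/\ w2 != 0, n2 != 0, dot w2 n2 = 0 & S2 = parabola v2 w2 n2],
        exists g, rigid_motion g /\ S2 = g @` S1,
        line v1 w1 = line v2 w2 &
        dot n1 n2 = 0 /\ w2 = - w1].

Definition matching_curves (S1 S2 : set E3) : Prop :=
  exists (a m b : R) (g : E3 -> E3),
    [/\ [/\ 0 < a, 0 < m, b != 0 & m != 1],
        rigid_motion g,
        S1 = g @` [set v | exists x y, v = vec3 x y 0 /\
                             m * x ^+ 2 + y ^+ 2 = a] &
        S2 = g @` [set v | exists x z, v = vec3 x 0 z /\
                             m / (m - 1) * x ^+ 2 + z ^+ 2 = b]].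

(* The conditions x != B and x != 0 below make explicit that the argument of ln
   is nonzero, as the library sets ln 0 = 0. *)
Definition log_circle (S : set E3) : Prop :=
  exists (A B D : R) (g : E3 -> E3),
    rigid_motion g /\
    S = g @` [set v | exists x y, [/\ v = vec3 x y 0, x != B &
                        x ^+ 2 + y ^+ 2 = D + A * ln `|x - B|]].

Definition matching_log_circles (S1 S2 : set E3) : Prop :=
  [/\ log_circle S1, log_circle S2 &
    exists (A B D D' k : R) (g : E3 -> E3),
      [/\ 0 < k, rigid_motion g,
          S1 = (fun v => g (k *: v)) @`
                 [set v | exists x y, [/\ v = vec3 x y 0, x != 0 &
                   (x - B) ^+ 2 + y ^+ 2 = D + A * ln `|x|]] &
          S2 = (fun v => g (k *: v)) @`
                 [set v | exists x z, [/\ v = vec3 x 0 z, x != B &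
                   x ^+ 2 + z ^+ 2 = D' + A * ln `|x - B|]]]].

Definition listed_pair (S1 S2 : set E3) : Prop :=
  line_and_orthogonal_curve S1 S2 \/
  parallel_lines S1 S2 \/
  line_and_cylinder_ellipse S1 S2 \/
  CPO_parabolas S1 S2 \/
  matching_curves S1 S2 \/
  matching_log_circles S1 S2.

End Defs.

(* Main.v *)
(* Choose coordinates in which the arcs are (x(s), y(s), 0) and (u(t), 0, z(t)).
   Then rho = P(s) + Q(t) - 2 x(s) u(t) with P = x^2 + y^2 and Q = u^2 + z^2.
   If x or u is constant near some point, one arc lies on a line orthogonal to
   the plane of the other.  Otherwise shrink the intervals so that x' and u' do
   not vanish.  If rho = phi3 (phi1 + phi2), then rho_s / rho_t is a function of
   s divided by a function of t, that is b(t) (f(s) - u(t)) = a(s) (g(t) - x(s))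
   with f = P' / 2x' and g = Q' / 2u'.  Linear algebra in dimension 4 gives
   f = (al + be x) / (ga + de x) and g = (al - ga u) / (de u - be).  Integrating
   these, de <> 0 yields matching log-circles, and de = 0 yields two conics with
   a common axis: matching curves, possibly degenerating to a line and an ellipse
   on a cylinder, CPO parabolas, or two parallel lines. *)

Require Import Defs.
From mathcomp Require Import all_boot all_order all_algebra.
From mathcomp Require Import all_classical all_reals all_analysis.
From mathcomp Require Import ring lra.

Set Implicit Arguments.
Unset Strict Implicit.
Unset Printing Implicit Defensive.

Import Order.TTheory GRing.Theory Num.Theory.
Import numFieldNormedType.Exports.

Local Open Scope classical_set_scope.
Local Open Scope ring_scope.

(** * Real functions and the functional equation *)

Section RealLemmas.
Context {R : realType}.
Implicit Types (I J : set R) (f g : R -> R) (s t d : R).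

Lemma derive0_interval_cst I f : is_interval I ->
  (forall s, I s -> is_derive s 1 f 0) ->
  forall s t, I s -> I t -> f s = f t.
Proof.
move=> itvI df.
have {}df s t : I s -> I t -> s <= t -> f s = f t.
  move=> Is It st.
  have dI r : r \in `[s, t] -> is_derive r 1 f 0.
    by rewrite in_itv /= => /itvI -/(_ Is It)/df.
  have cf : {within `[s, t], continuous f}.
    by apply: derivable_within_continuous => r /dI df0; exact: ex_derive.
  have df0 r : r \in `]s, t[ -> is_derive r 1 f ((fun=> 0) r).
    by move=> rst; apply: dI; exact: subset_itv_oo_cc rst.
  have [c _ /eqP] := MVT_segment st df0 cf.
  by rewrite mul0r subr_eq0 => /eqP.
by move=> s t Is It; have [/df|/ltW/df] := leP s t => ->.
Qed.

Lemma is_derive_continuous f s d : is_derive s 1 f d -> {for s, continuous f}.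
Proof.
by move=> fs; apply/differentiable_continuous/derivable1_diffP/ex_derive.
Qed.

Lemma open_neq0 J f : open J -> (forall s, J s -> {for s, continuous f}) ->
  forall s, J s -> f s != 0 ->
  exists K : set R, [/\ open_interval K, K `<=` J & forall r, K r -> f r != 0].
Proof.
move=> oJ cf s Js fs.
have : \forall r \near s, J r /\ f r != 0.
  near=> r; split; near: r; first exact: open_nbhs_nbhs.
  exact: (cvgr_neq0 _ (cf s Js)).
move=> /nbhs_ballP[e /= e0 eJ]; exists (ball s e); split.
- split; [exact: ball_open|rewrite ball_itv|by exists s; exact: ballxx].
  exact: interval_is_interval.
- by move=> r /eJ[].
- by move=> r /eJ[].
Unshelve. all: by end_near. Qed.

Lemma sqr_eq_open J f g : open J -> J !=set0 ->
  (forall s, J s -> {for s, continuous f}) ->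
  (forall s, J s -> {for s, continuous g}) ->
  (forall s, J s -> f s ^+ 2 = g s ^+ 2) ->
  exists (K : set R) (e : R), [/\ open K, K !=set0, K `<=` J, e ^+ 2 = 1 &
    forall s, K s -> f s = e * g s].
Proof.
move=> oJ J0 cf cg fg.
have [fgE|/existsNP[s /not_implyP[Js /eqP fgs]]] :=
  pselect (forall s, J s -> f s = g s).
  by exists J, 1; split=> // [|s /fgE ->]; rewrite ?expr1n ?mul1r.
have [||K [[oK _ K0] KJ nfg]] := @open_neq0 J (f - g) oJ _ s Js.
- by move=> r Jr; apply: cvgB; [exact: cf|exact: cg].
- by rewrite subr_eq0.
exists K, (-1); split=> // [|r Kr]; first by rewrite sqrrN expr1n.
have /eqP := fg r (KJ _ Kr); rewrite eqf_sqr mulN1r => /orP[/eqP fgr|/eqP//].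
have : f r - g r != 0 by exact: nfg.
by rewrite fgr subrr eqxx.
Qed.

Lemma open_neq_derive J f d s : open J -> J s -> is_derive s 1 f d -> d != 0 ->
  exists2 r, J r & f r != f s.
Proof.
move=> oJ Js df d0; apply: contrapT => fcst.
have fE r : J r -> f r = f s.
  by move=> Jr; apply/eqP/negPn/negP => fr; apply: fcst; exists r.
suff : is_derive s 1 f 0.
  move=> df0; have := @derive_val _ _ _ _ _ _ _ df.
  by rewrite (@derive_val _ _ _ _ _ _ _ df0) => /esym/eqP; rewrite (negbTE d0).
apply: (@near_eq_is_derive _ _ _ (cst (f s))) => //.
near=> r; rewrite /cst; apply/esym/fE; near: r; exact: open_nbhs_nbhs.
Unshelve. all: by end_near. Qed.

End RealLemmas.

(* The equation says that the vectors [(f, a x, a, 1)] and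
   [(b, 1, -g, -b u)] of F^4 are orthogonal; both families span at least a
   plane, so both span exactly a plane. *)
Lemma separated_homography (F : fieldType) (S T : Type) (J1 : set S) (J2 : set T)
    (x f a : S -> F) (u g b : T -> F) :
  (forall s, J1 s -> a s != 0) -> (forall t, J2 t -> b t != 0) ->
  (forall s t, J1 s -> J2 t -> b t * (f s - u t) = a s * (g t - x s)) ->
  (exists s1 s2, [/\ J1 s1, J1 s2 & x s1 != x s2]) ->
  (exists t1 t2, [/\ J2 t1, J2 t2 & u t1 != u t2]) ->
  exists al be ga de : F,
    (forall s, J1 s -> ga + de * x s != 0 /\
       f s * (ga + de * x s) = al + be * x s) /\
    (forall t, J2 t -> de * u t - be != 0 /\
       g t * (de * u t - be) = al - ga * u t).
Proof.
move=> a0 b0 E [s1 [s2 [Js1 Js2 x12]]] [t1 [t2 [Jt1 Jt2 u12]]].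
have b1 := b0 _ Jt1; have b2 := b0 _ Jt2.
have u21 : u t2 - u t1 != 0 by rewrite subr_eq0 eq_sym.
pose ga := (g t1 / b t1 - g t2 / b t2) / (u t2 - u t1).
pose de := ((b t2)^-1 - (b t1)^-1) / (u t2 - u t1).
have aE s : J1 s -> a s * (ga + de * x s) = 1.
  move=> Js; have E1 := E _ _ Js Jt1; have E2 := E _ _ Js Jt2.
  have F1 : a s * (g t1 - x s) / b t1 = f s - u t1 by rewrite -E1; field.
  have F2 : a s * (g t2 - x s) / b t2 = f s - u t2 by rewrite -E2; field.
  rewrite /ga /de; apply: (mulfI u21); rewrite mulr1.
  transitivity (a s * (g t1 - x s) / b t1 - a s * (g t2 - x s) / b t2).
    by field; rewrite u21 b1 b2.
  by rewrite F1 F2; ring.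
pose al := u t1 * ga + g t1 / b t1; pose be := u t1 * de - (b t1)^-1.
have fE s : J1 s -> f s = a s * (al + be * x s).
  move=> Js; have E1 := E _ _ Js Jt1.
  have -> : f s = u t1 + a s * (g t1 - x s) / b t1 by rewrite -E1; field.
  rewrite -[X in X + _]mulr1 -(aE _ Js) /al /be; by field.
have K t s : J2 t -> J1 s ->
    b t * (al + be * x s - u t * (ga + de * x s)) = g t - x s.
  move=> Jt Js; apply: (mulfI (a0 _ Js)); rewrite -(E _ _ Js Jt) (fE _ Js).
  rewrite -[in RHS](mulr1 (u t)) -(aE _ Js); by ring.
have K' t : J2 t -> b t * (de * u t - be) = 1.
  move=> Jt; have := K _ _ Jt Js1; have := K _ _ Jt Js2 => K2 K1.
  have x0 : x s1 - x s2 != 0 by rewrite subr_eq0.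
  apply: (mulfI x0); rewrite mulr1.
  transitivity ((g t - x s2) - (g t - x s1)); last by ring.
  by rewrite -K1 -K2; ring.
exists al, be, ga, de; split=> [s Js|t Jt].
  split; last by rewrite (fE _ Js) mulrAC (aE _ Js) mul1r.
  by apply/eqP => z; have /eqP := aE _ Js; rewrite z mulr0 eq_sym oner_eq0.
split.
  by apply/eqP => z; have /eqP := K' _ Jt; rewrite z mulr0 eq_sym oner_eq0.
have -> : g t = b t * (al - ga * u t).
  transitivity ((g t - x s1) + x s1 * 1); first by ring.
  rewrite -(K _ _ Jt Js1) -(K' _ Jt); by ring.
by rewrite mulrAC (K' _ Jt) mul1r.
Qed.


Section Integration.
Context {R : realType}.
Implicit Types (I J : set R) (s t r : R).

Lemma is_derive_near_unique J (f g : R -> R) s d e : open J -> J s ->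
  (forall r, J r -> f r = g r) ->
  is_derive s (1 : R) f d -> is_derive s (1 : R) g e -> d = e.
Proof.
move=> oJ Js fg df dg.
have df' : is_derive s (1 : R) f e.
  apply: (@near_eq_is_derive _ _ _ g) => //.
  near=> r; apply/esym/fg; near: r; exact: open_nbhs_nbhs.
have := @derive_val _ _ _ _ _ _ _ df.
by rewrite (@derive_val _ _ _ _ _ _ _ df').
Unshelve. all: by end_near. Qed.

Lemma separated_derivatives I1 I2 (x dx P dP u du Q dQ phi1 phi2 phi3 : R -> R) :
  open I1 -> open I2 -> I1 !=set0 -> I2 !=set0 ->
  (forall s, I1 s -> is_derive s (1 : R) x (dx s)) ->
  (forall s, I1 s -> is_derive s (1 : R) P (dP s)) ->
  (forall t, I2 t -> is_derive t (1 : R) u (du t)) ->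
  (forall t, I2 t -> is_derive t (1 : R) Q (dQ t)) ->
  (forall s, I1 s -> dx s != 0) -> (forall t, I2 t -> du t != 0) ->
  (forall s, I1 s -> derivable phi1 s 1) ->
  (forall t, I2 t -> derivable phi2 t 1) ->
  (forall s t, I1 s -> I2 t -> derivable phi3 (phi1 s + phi2 t) 1) ->
  (forall s t, I1 s -> I2 t ->
     P s + Q t - 2 * (x s * u t) = phi3 (phi1 s + phi2 t)) ->
  exists al be ga de : R,
    (forall s, I1 s -> ga + de * x s != 0 /\
       dP s * (ga + de * x s) = 2 * dx s * (al + be * x s)) /\
    (forall t, I2 t -> - be + de * u t != 0 /\
       dQ t * (- be + de * u t) = 2 * du t * (al - ga * u t)).
Proof.
move=> oI1 oI2 [s0 Is0] [t0 It0] Dx DP Du DQ dx0 du0 Dphi1 Dphi2 Dphi3 E.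
pose k s t := phi3^`()%classic (phi1 s + phi2 t).
have Es s t : I1 s -> I2 t -> dP s - 2 * (dx s * u t) = k s t * phi1^`()%classic s.
  move=> Is It; have ? := Dx _ Is; have ? := DP _ Is.
  apply: (@is_derive_near_unique I1 (fun r => P r + Q t - 2 * (x r * u t))
    (fun r => phi3 (phi1 r + phi2 t)) s) => // [r Ir||]; first exact: E.
    by apply: is_derive_eq; rewrite /GRing.scale /=; ring.
  apply: (@is_derive1_comp _ phi3 (fun s => phi1 s + phi2 t)).
    by rewrite /k derive1E; exact/derivableP/Dphi3.
  have ? := derivableP (Dphi1 _ Is).
  by apply: is_derive_eq; rewrite addr0 derive1E.
have Et s t : I1 s -> I2 t -> dQ t - 2 * (x s * du t) = k s t * phi2^`()%classic t.
  move=> Is It; have ? := Du _ It; have ? := DQ _ It.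
  apply: (@is_derive_near_unique I2 (fun r => P s + Q r - 2 * (x s * u r))
    (fun r => phi3 (phi1 s + phi2 r)) t) => // [r Ir||]; first exact: E.
    by apply: is_derive_eq; rewrite /GRing.scale /=; ring.
  apply: (@is_derive1_comp _ phi3 (fun t => phi1 s + phi2 t)).
    by rewrite /k derive1E; exact/derivableP/Dphi3.
  have ? := derivableP (Dphi2 _ It).
  by apply: is_derive_eq; rewrite add0r mul1r derive1E.
have [s1 Is1 s01] := open_neq_derive oI1 Is0 (Dx _ Is0) (dx0 _ Is0).
have [t1 It1 t01] := open_neq_derive oI2 It0 (Du _ It0) (du0 _ It0).
have phi1_neq0 s : I1 s -> phi1^`()%classic s != 0.
  move=> Is; apply: contra_neq t01 => z.
  have := Es _ _ Is It0; have := Es _ _ Is It1; rewrite z !mulr0 => F1 F0.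
  by apply: (mulfI (dx0 _ Is)); lra.
have phi2_neq0 t : I2 t -> phi2^`()%classic t != 0.
  move=> It; apply: contra_neq s01 => z.
  have := Et _ _ Is0 It; have := Et _ _ Is1 It; rewrite z !mulr0 => F1 F0.
  by apply: (mulIf (du0 _ It)); lra.
have := @separated_homography R R R I1 I2 x (fun s => dP s / (2 * dx s))
  (fun s => phi1^`()%classic s / dx s) u (fun t => dQ t / (2 * du t))
  (fun t => phi2^`()%classic t / du t).
case=> [s Is|t It|s t Is It| | |al [be [ga [de [H1 H2]]]]].
- by rewrite mulf_neq0 ?invr_eq0 ?phi1_neq0 ?dx0.
- by rewrite mulf_neq0 ?invr_eq0 ?phi2_neq0 ?du0.
- have {}Es := Es _ _ Is It; have {}Et := Et _ _ Is It.
  have dxs := dx0 _ Is; have dut := du0 _ It.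
  have -> : dP s / (2 * dx s) - u t = k s t * phi1^`()%classic s / (2 * dx s).
    by rewrite -Es; field.
  have -> : dQ t / (2 * du t) - x s = k s t * phi2^`()%classic t / (2 * du t).
    by rewrite -Et; field.
  by field; rewrite dxs dut.
- by exists s1, s0.
- by exists t1, t0.
exists al, be, ga, de; split=> [s Is|t It].
  have [-> H] := H1 _ Is; split=> //; rewrite -H; field; exact: dx0.
have [n H] := H2 _ It; rewrite [- be + _]addrC; split=> //.
by rewrite -H; field; exact: du0.
Qed.

Lemma integrate_affine I (x dx P dP : R -> R) (al be ga : R) :
  is_interval I -> I !=set0 ->
  (forall s, I s -> is_derive s (1 : R) x (dx s)) ->
  (forall s, I s -> is_derive s (1 : R) P (dP s)) ->
  (forall s, I s -> dP s * ga = 2 * dx s * (al + be * x s)) ->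
  exists c, forall s, I s -> ga * P s = 2 * al * x s + be * x s ^+ 2 + c.
Proof.
move=> itvI [s0 Is0] Dx DP E.
pose h s := ga * P s - 2 * al * x s - be * (x s * x s).
have Dh s : I s -> is_derive s (1 : R) h 0.
  move=> Is; have ? := Dx _ Is; have ? := DP _ Is.
  apply: is_derive_eq; rewrite /GRing.scale /=.
  have := E _ Is; nra.
exists (h s0) => s Is; rewrite -(derive0_interval_cst itvI Dh Is Is0) /h.
by ring.
Qed.

Lemma integrate_homography I (x dx P dP : R -> R) (al be ga : R) :
  is_interval I -> I !=set0 ->
  (forall s, I s -> is_derive s (1 : R) x (dx s)) ->
  (forall s, I s -> is_derive s (1 : R) P (dP s)) ->
  (forall s, I s -> ga + x s != 0 /\
    dP s * (ga + x s) = 2 * dx s * (al + be * x s)) ->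
  exists c, forall s, I s ->
    P s = 2 * be * x s + 2 * (al - be * ga) * ln `|x s + ga| + c.
Proof.
move=> itvI [s0 Is0] Dx DP E.
pose h s := P s - 2 * be * x s -
  (al - be * ga) * ln ((ga + x s) * (ga + x s)).
have Dh s : I s -> is_derive s (1 : R) h 0.
  move=> Is; have ? := Dx _ Is; have ? := DP _ Is; have [n0 Es] := E _ Is.
  have sqr_gt0 : 0 < (ga + x s) * (ga + x s) by rewrite -expr2 exprn_even_gt0.
  have dln := is_derive1_ln sqr_gt0.
  have dsq : is_derive s (1 : R) (fun s => (ga + x s) * (ga + x s))
      (2 * (ga + x s) * dx s).
    by apply: is_derive_eq; rewrite /GRing.scale /=; ring.
  have ? := @is_derive1_comp _ (@ln R) (fun s => (ga + x s) * (ga + x s))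
    _ _ _ dln dsq.
  rewrite (_ : h = fun s => P s - 2 * be * x s - (al - be * ga) *
    (@ln R \o (fun s => (ga + x s) * (ga + x s))) s) //.
  apply: is_derive_eq; rewrite /GRing.scale /=.
  have -> : dP s = 2 * dx s * (al + be * x s) / (ga + x s).
    by rewrite -Es; field.
  by field.
exists (h s0) => s Is; rewrite -(derive0_interval_cst itvI Dh Is Is0) /h.
have [n0 _] := E _ Is.
have -> : (ga + x s) * (ga + x s) = `|x s + ga| ^+ 2.
  by rewrite real_normK ?num_real // addrC expr2.
rewrite lnXn ?normr_gt0 1?addrC // mulr2n; ring.
Qed.

End Integration.

(** * The listed pairs in standard position *)

Section Geometry.
Context {R : realType}.
Local Notation E3 := 'rV[R]_3.
Implicit Types (U H : 'M[R]_3) (c v w p n : E3).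

Definition rotation U := U *m U^T = 1%:M /\ \det U = 1.

Definition motion U c : E3 -> E3 := fun v => v *m U + c.

Lemma rigid_motion_motion U c : rotation U -> rigid_motion (motion U c).
Proof. by move=> [UU dU]; exists U, c; split. Qed.

Lemma rotation_mul U H : rotation U -> rotation H -> rotation (U *m H).
Proof.
move=> [UU dU] [HH dH]; split; last by rewrite det_mulmx dU dH mulr1.
by rewrite trmx_mul mulmxA -(mulmxA U) HH mulmx1.
Qed.

Lemma rotation_tr U : rotation U -> rotation U^T.
Proof.
by move=> [UU dU]; split; [rewrite trmxK; exact: mulmx1C|rewrite det_tr].
Qed.

Lemma motionB U c v w : motion U c v - motion U c w = (v - w) *m U.
Proof. by rewrite /motion mulmxBl opprD addrACA subrr addr0. Qed.

Lemma motion_shift U c v w : motion U (w *m U + c) v = motion U c (v + w).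
Proof. by rewrite /motion mulmxDl addrA. Qed.

Lemma dot_rotation U v w : rotation U -> dot (v *m U) (w *m U) = dot v w.
Proof.
by move=> [UU _]; rewrite /dot trmx_mul mulmxA -(mulmxA v) UU mulmx1.
Qed.

Lemma vec3_coords v : v = vec3 (v 0 0) (v 0 1) (v 0 2).
Proof.
apply/rowP => -[[|[|[|]]]] //= i; rewrite !mxE /=; congr (v _ _); exact/val_inj.
Qed.

Lemma vec3D x y z x' y' z' :
  @vec3 R x y z + vec3 x' y' z' = vec3 (x + x') (y + y') (z + z').
Proof. by apply/rowP => -[[|[|[|]]]] //= i; rewrite !mxE. Qed.

Lemma vec3N x y z : - @vec3 R x y z = vec3 (- x) (- y) (- z).
Proof. by apply/rowP => -[[|[|[|]]]] //= i; rewrite !mxE. Qed.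

Lemma vec3Z k x y z : k *: @vec3 R x y z = vec3 (k * x) (k * y) (k * z).
Proof. by apply/rowP => -[[|[|[|]]]] //= i; rewrite !mxE. Qed.

Lemma vec3_eq0 x y z : (@vec3 R x y z == 0) = [&& x == 0, y == 0 & z == 0].
Proof.
apply/eqP/and3P => [/rowP v0|[/eqP-> /eqP-> /eqP->]].
  by have := v0 0; have := v0 1; have := v0 2; rewrite !mxE /= => -> -> ->.
by apply/rowP => -[[|[|[|]]]] //= i; rewrite !mxE.
Qed.

Lemma dotE v w : dot v w = v 0 0 * w 0 0 + v 0 1 * w 0 1 + v 0 2 * w 0 2.
Proof.
rewrite /dot mxE !big_ord_recl big_ord0 !mxE addr0 addrA.
by congr (_ * _ + _ * _ + _ * _); congr (_ _ _); exact/val_inj.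
Qed.

Lemma dot_vec3 x y z x' y' z' :
  dot (@vec3 R x y z) (vec3 x' y' z') = x * x' + y * y' + z * z'.
Proof. by rewrite dotE !mxE. Qed.

Lemma det_mx33 (A : 'M[R]_3) : \det A =
  A 0 0 * (A 1 1 * A 2 2 - A 1 2 * A 2 1)
  - A 0 1 * (A 1 0 * A 2 2 - A 1 2 * A 2 0)
  + A 0 2 * (A 1 0 * A 2 1 - A 1 1 * A 2 0).
Proof.
pose F (i j : nat) := A (inord i) (inord j).
have AE : A = \matrix_(i, j) F i j.
  by apply/matrixP => i j; rewrite mxE /F !inord_val.
rewrite AE (expand_det_row _ 0) !big_ord_recl big_ord0 /cofactor.
rewrite !(expand_det_row _ 0) !big_ord_recl !big_ord0 /cofactor !det_mx11.
rewrite !mxE /= /bump /= !(addn0, add0n, addn1) !(expr0, expr1, sqrrN, expr1n).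
rewrite /bump /=; ring.
Qed.

Definition mat3 (r1 r2 r3 : E3) : 'M[R]_3 :=
  \matrix_(i, j) ([:: r1; r2; r3]`_i : E3) 0 j.

Lemma vec3_mat3 x y z r1 r2 r3 :
  vec3 x y z *m mat3 r1 r2 r3 = x *: r1 + y *: r2 + z *: r3.
Proof.
by apply/rowP => j; rewrite !mxE !big_ord_recl big_ord0 !mxE /= addr0 addrA.
Qed.

Lemma mat3_rotation r1 r2 r3 :
  dot r1 r1 = 1 -> dot r2 r2 = 1 -> dot r3 r3 = 1 ->
  dot r1 r2 = 0 -> dot r1 r3 = 0 -> dot r2 r3 = 0 ->
  r1 0 0 * (r2 0 1 * r3 0 2 - r2 0 2 * r3 0 1)
  - r1 0 1 * (r2 0 0 * r3 0 2 - r2 0 2 * r3 0 0)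
  + r1 0 2 * (r2 0 0 * r3 0 1 - r2 0 1 * r3 0 0) = 1 ->
  rotation (mat3 r1 r2 r3).
Proof.
move=> d11 d22 d33 d12 d13 d23 d; split.
  have dotC v w : dot v w = dot w v by rewrite !dotE; ring.
  have E i j : (mat3 r1 r2 r3 *m (mat3 r1 r2 r3)^T) i j =
      dot (row i (mat3 r1 r2 r3)) (row j (mat3 r1 r2 r3)).
    by rewrite /dot !mxE; apply: eq_bigr => k _; rewrite !mxE.
  have rowE i : row i (mat3 r1 r2 r3) = [:: r1; r2; r3]`_i.
    by apply/rowP => k; rewrite !mxE.
  apply/matrixP => i j; rewrite E !rowE mxE.
  by move: i j => [[|[|[|]]]] //= i [[|[|[|]]]] //= j; rewrite // dotC.
by rewrite det_mx33 -d !mxE.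
Qed.

End Geometry.

Section StandardPairs.
Context {R : realType}.
Local Notation E3 := 'rV[R]_3.
Implicit Types (U H : 'M[R]_3) (c v w p n : E3).

(* Row vectors are acted on from the right: (x, y, z) is sent to (x, -z, y), so
   the two coordinate planes carrying the arcs are exchanged. *)
Definition turn : 'M[R]_3 := mat3 (vec3 1 0 0) (vec3 0 0 1) (vec3 0 (-1) 0).

Lemma turn_rotation : rotation turn.
Proof. by apply: mat3_rotation; rewrite ?dot_vec3 ?mxE /=; ring. Qed.

Lemma vec3_turn x y z : vec3 x y z *m turn = vec3 x (- z) y.
Proof.
by rewrite vec3_mat3 !vec3Z !vec3D; congr vec3; ring.
Qed.

Lemma motion_turn U c x y z :
  motion (turn *m U) c (vec3 x y z) = motion U c (vec3 x (- z) y).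
Proof. by rewrite /motion mulmxA vec3_turn. Qed.

Lemma parallel_standard U c a b a' b' : rotation U ->
  exists S1 S2, [/\ parallel_lines S1 S2,
    forall x, S1 (motion U c (vec3 x a b)) &
    forall x, S2 (motion U c (vec3 x a' b'))].
Proof.
move=> rU; pose w := @vec3 R 1 0 0 *m U.
have lineE a0 b0 x : line (motion U c (vec3 0 a0 b0)) w (motion U c (vec3 x a0 b0)).
  exists x; rewrite /motion addrAC /w scalemxAl -mulmxDl vec3Z vec3D.
  by congr (vec3 _ _ _ *m _ + _); ring.
exists (line (motion U c (vec3 0 a b)) w), (line (motion U c (vec3 0 a' b')) w).
split=> //.
exists (motion U c (vec3 0 a b)), (motion U c (vec3 0 a' b')), w; split=> //.
apply/eqP => w0; have := dot_rotation (vec3 1 0 0) (vec3 1 0 0) rU.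
rewrite -/w w0 /dot mul0mx mxE -/(dot _ _) dot_vec3 => /eqP.
by rewrite !mulr0 !addr0 mulr1 eq_sym oner_eq0.
Qed.

Lemma rotation_eq0 U v : rotation U -> (v *m U == 0) = (v == 0).
Proof.
move=> [UU _]; apply/eqP/eqP => [vU|->]; last by rewrite mul0mx.
by rewrite -(mulmx1 v) -UU mulmxA vU mul0mx.
Qed.

Lemma parabola_motion U c v w n : rotation U ->
  parabola (motion U c v) (w *m U) (n *m U) = motion U c @` parabola v w n.
Proof.
move=> rU.
have E p : parabola (motion U c v) (w *m U) (n *m U) (motion U c p) =
    parabola v w n p.
  rewrite /parabola /plane /sqdist /=.
  have -> : motion U c v + w *m U = motion U c (v + w).
    by rewrite /motion mulmxDl addrAC.
  have -> : motion U c v - w *m U = motion U c (v - w).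
    by rewrite /motion mulmxBl addrAC.
  by rewrite !motionB !(dot_rotation _ _ rU).
have [UU _] := rotation_tr rU; rewrite trmxK in UU.
rewrite predeqE => q; split=> [|[p pp <-]]; last by rewrite E.
have -> : q = motion U c ((q - c) *m U^T).
  by rewrite /motion -mulmxA UU mulmx1 subrK.
by rewrite E => pq; exists ((q - c) *m U^T).
Qed.

Lemma line_opposite v w a : line v w = line (v + a *: w) (- w).
Proof.
rewrite predeqE => q; split=> -[t ->]; exists (a - t);
by apply/rowP => i; rewrite !mxE; ring.
Qed.

Lemma parabola_xy x0 k x y : k != 0 -> y ^+ 2 = 2 * k * (x - x0) ->
  parabola (vec3 x0 0 0) (vec3 (k / 2) 0 0) (@vec3 R 0 0 1) (vec3 x y 0).
Proof.
move=> k0 yE; rewrite /parabola /plane /sqdist /=.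
rewrite !(vec3N, vec3D, dot_vec3); split; first by ring.
have -> : (y + - (0 + 0)) * (y + - (0 + 0)) = 2 * k * (x - x0).
  by rewrite -yE; ring.
by field.
Qed.

Lemma CPO_standard U c k x1 x2 : rotation U -> k != 0 ->
  exists S1 S2, [/\ CPO_parabolas S1 S2,
    forall x y, y ^+ 2 = 2 * k * (x - x1) -> S1 (motion U c (vec3 x y 0)) &
    forall x z, z ^+ 2 = - (2 * k * (x - x2)) -> S2 (motion U c (vec3 x 0 z))].
Proof.
move=> rU k0.
have k20 : k / 2 != 0 by rewrite mulf_neq0 ?invr_eq0 // pnatr_eq0.
pose v1 := motion U c (vec3 x1 0 0); pose v2 := motion U c (vec3 x2 0 0).
pose w1 := vec3 (k / 2) 0 0 *m U.
pose n1 := vec3 0 0 1 *m U; pose n2 := vec3 0 (- 1) 0 *m U.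
pose H0 : 'M[R]_3 := mat3 (vec3 (-1) 0 0) (vec3 0 0 (-1)) (vec3 0 (-1) 0).
have rH0 : rotation H0.
  by apply: mat3_rotation; rewrite ?dot_vec3 ?mxE /=; ring.
have UU : U *m U^T = 1%:M by case: rU.
pose H := U^T *m (H0 *m U).
have rH : rotation H.
  by apply: rotation_mul; [exact: rotation_tr|exact: rotation_mul].
have UH v : v *m U *m H = v *m H0 *m U.
  by rewrite /H !mulmxA -(mulmxA v) UU mulmx1.
have w2E : w1 *m H = - w1.
  rewrite /w1 UH -mulNmx vec3_mat3 vec3N !vec3Z !vec3D.
  by congr (vec3 _ _ _ *m _); ring.
have n2E : n1 *m H = n2.
  rewrite /n1 UH vec3_mat3 !vec3Z !vec3D.
  by congr (vec3 _ _ _ *m _); ring.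
exists (parabola v1 w1 n1), (parabola v2 (- w1) n2); split.
- exists v1, w1, n1, v2, (- w1), n2; split.
  + rewrite /w1 /n1 !rotation_eq0 // !(dot_rotation _ _ rU) dot_vec3 !vec3_eq0.
    by rewrite (negbTE k20) oner_eq0 !andbF; split=> //; ring.
  + rewrite oppr_eq0 /w1 /n2 -mulNmx !rotation_eq0 // !(dot_rotation _ _ rU).
    rewrite vec3N dot_vec3 !vec3_eq0 (negbTE k20) oppr_eq0 oner_eq0.
    by rewrite !andbF; split=> //; ring.
  + exists (motion H (v2 - v1 *m H)); split; first exact: rigid_motion_motion.
    rewrite -parabola_motion // w2E n2E; congr parabola.
    by rewrite /motion addrC subrK.
  + rewrite (line_opposite _ _ ((x2 - x1) / (k / 2))); congr line.
    rewrite /v1 /v2 /w1 /motion scalemxAl addrAC -mulmxDl vec3Z vec3D.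
    by congr (vec3 _ _ _ *m _ + _); field.
  + by rewrite /n1 /n2 !(dot_rotation _ _ rU) dot_vec3; split=> //; ring.
- move=> x y yE; rewrite /v1 /w1 /n1 parabola_motion //.
  by exists (vec3 x y 0) => //; exact: parabola_xy.
move=> x z zE.
have -> : parabola v2 (- w1) n2 = parabola
    (motion (turn *m U) c (vec3 x2 0 0)) (vec3 (- k / 2) 0 0 *m (turn *m U))
    (vec3 0 0 1 *m (turn *m U)).
  rewrite motion_turn oppr0 !mulmxA !vec3_turn oppr0 /w1 -mulNmx vec3N !oppr0.
  by rewrite mulNr.
rewrite parabola_motion; last exact: rotation_mul turn_rotation rU.
exists (vec3 x z 0); last by rewrite motion_turn oppr0.
by apply: parabola_xy; rewrite ?oppr_eq0 // zE; ring.
Qed.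

Lemma matching_standard U c m a b : rotation U ->
  0 < a -> 0 < m -> b != 0 -> m != 1 ->
  exists S1 S2, [/\ matching_curves S1 S2,
    forall x y, m * x ^+ 2 + y ^+ 2 = a -> S1 (motion U c (vec3 x y 0)) &
    forall x z, m / (m - 1) * x ^+ 2 + z ^+ 2 = b ->
      S2 (motion U c (vec3 x 0 z))].
Proof.
move=> rU a0 m0 b0 m1.
exists (motion U c @` [set v | exists x y, v = vec3 x y 0 /\
  m * x ^+ 2 + y ^+ 2 = a]), (motion U c @` [set v | exists x z,
  v = vec3 x 0 z /\ m / (m - 1) * x ^+ 2 + z ^+ 2 = b]); split.
- exists a, m, b, (motion U c); split=> //; exact: rigid_motion_motion.
- by move=> x y E; exists (vec3 x y 0) => //; exists x, y.
- by move=> x z E; exists (vec3 x 0 z) => //; exists x, z.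
Qed.

Lemma cylinder_standard U c m a k : rotation U ->
  0 < a -> 0 < m -> m != 1 -> k ^+ 2 = m / (1 - m) ->
  exists S1 S2, [/\ line_and_cylinder_ellipse S1 S2,
    forall x, S1 (motion U c (vec3 x 0 (k * x))) &
    forall x y, m * x ^+ 2 + y ^+ 2 = a -> S2 (motion U c (vec3 x y 0))].
Proof.
move=> rU a0 m0 m1 kE.
have m1' : 1 - m != 0 by rewrite subr_eq0 eq_sym.
have k1 : 1 + k ^+ 2 != 0 by rewrite gt_eqF // ltr_pwDl // sqr_ge0.
have tE t : c + t *: (vec3 1 0 k *m U) = motion U c (vec3 t 0 (k * t)).
  rewrite /motion addrC scalemxAl vec3Z; congr (vec3 _ _ _ *m _ + _); ring.
have sqrt_a0 : 0 < Num.sqrt a by rewrite sqrtr_gt0.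
have am0 : 0 < a / m by rewrite divr_gt0.
have mE x y : m * x ^+ 2 + y ^+ 2 =
    a * ((x / Num.sqrt (a / m)) ^+ 2 + (y / Num.sqrt a) ^+ 2).
  by rewrite !expr_div_n !sqr_sqrtr ?ltW //; field; rewrite !gt_eqF.
pose S2 := motion U c @` [set v | exists x y, v = vec3 x y 0 /\
  (x / Num.sqrt (a / m)) ^+ 2 + (y / Num.sqrt a) ^+ 2 = 1].
exists (line c (vec3 1 0 k *m U)), S2; split.
- exists c, (vec3 1 0 k *m U), (Num.sqrt a); split=> //.
  + by rewrite rotation_eq0 // vec3_eq0 oner_eq0.
  + exists (Num.sqrt (a / m)), (Num.sqrt a), (motion U c).
    by split; rewrite ?sqrtr_gt0 //; exact: rigid_motion_motion.
  move=> _ [_ [x [y [-> E]]] <-].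
  have {}E : m * x ^+ 2 + y ^+ 2 = a by rewrite mE E mulr1.
  exists (x / (1 + k ^+ 2)); rewrite /sqdist tE !motionB !(dot_rotation _ _ rU).
  rewrite vec3N vec3D !dot_vec3 sqr_sqrtr ?ltW //; split; first by field.
  have kE' : 1 + k ^+ 2 = (1 - m)^-1 by rewrite kE; field.
  rewrite kE' invrK -[RHS]E.
  transitivity (m ^+ 2 * x ^+ 2 + y ^+ 2 + k ^+ 2 * (1 - m) ^+ 2 * x ^+ 2).
    by ring.
  by rewrite kE; field.
- by move=> x; exists x; rewrite tE.
move=> x y E; exists (vec3 x y 0) => //; exists x, y; split=> //.
by apply: (mulfI (lt0r_neq0 a0)); rewrite -mE mulr1.
Qed.

Lemma log_circles_standard U c A B D D' : rotation U ->
  exists S1 S2, [/\ matching_log_circles S1 S2,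
    forall x y, x != 0 -> (x - B) ^+ 2 + y ^+ 2 = D + A * ln `|x| ->
      S1 (motion U c (vec3 x y 0)) &
    forall x z, x != B -> x ^+ 2 + z ^+ 2 = D' + A * ln `|x - B| ->
      S2 (motion U c (vec3 x 0 z))].
Proof.
move=> rU; pose g := fun v => motion U c (1 *: v).
pose S1 := g @` [set v | exists x y, [/\ v = vec3 x y 0, x != 0 &
  (x - B) ^+ 2 + y ^+ 2 = D + A * ln `|x|]].
pose S2 := g @` [set v | exists x z, [/\ v = vec3 x 0 z, x != B &
  x ^+ 2 + z ^+ 2 = D' + A * ln `|x - B|]].
exists S1, S2; split.
- split.
  + exists A, (- B), D, (motion U (vec3 B 0 0 *m U + c)).
    split; first exact: rigid_motion_motion.
    rewrite predeqE => q; split=> -[_ [x [y [-> x0 E]]] <-].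
      exists (vec3 (x - B) y 0).
        exists (x - B), y; rewrite opprK subrK; split=> //.
        by rewrite -subr_eq0 opprK subrK.
      by rewrite motion_shift vec3D subrK !addr0 /g scale1r.
    exists (vec3 (x + B) y 0).
      by rewrite opprK in E; exists (x + B), y; rewrite addrK addr_eq0.
    by rewrite motion_shift vec3D !addr0 /g scale1r.
  + exists A, B, D', (motion (turn *m U) c); split.
      by apply: rigid_motion_motion; exact: rotation_mul turn_rotation rU.
    rewrite predeqE => q; split=> -[_ [x [z [-> xB E]]] <-].
      by exists (vec3 x z 0); [exists x, z|rewrite motion_turn oppr0 /g scale1r].
    by exists (vec3 x 0 z); [exists x, z|rewrite motion_turn oppr0 /g scale1r].
  + exists A, B, D, D', 1, (motion U c); split=> //.
    exact: rigid_motion_motion.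
- move=> x y x0 E; exists (vec3 x y 0); last by rewrite /g scale1r.
  by exists x, y.
- move=> x z xB E; exists (vec3 x 0 z); last by rewrite /g scale1r.
  by exists x, z.
Qed.

End StandardPairs.

(** * From the equations to the listed pairs *)

Section LocalListing.
Context {R : realType}.
Local Notation E3 := 'rV[R]_3.
Implicit Types (U : 'M[R]_3) (c v w p n : E3) (J : set R) (g : R -> E3).

Definition continuous_on J (f : R -> R) := forall s, J s -> {for s, continuous f}.

Definition nonconstant_on J (f : R -> R) :=
  exists s1 s2, [/\ J s1, J s2 & f s1 != f s2].

Definition locally_listed J1 J2 g1 g2 :=
  exists K1 K2 S1 S2, [/\ [/\ open K1, K1 !=set0 & K1 `<=` J1],
    [/\ open K2, K2 !=set0 & K2 `<=` J2], listed_pair S1 S2 &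
    ((forall s, K1 s -> S1 (g1 s)) /\ (forall t, K2 t -> S2 (g2 t))) \/
    ((forall s, K1 s -> S2 (g1 s)) /\ (forall t, K2 t -> S1 (g2 t)))].

Lemma locally_listed_intro J1 J2 K1 K2 g1 g2 S1 S2 :
  listed_pair S1 S2 -> open K1 -> K1 !=set0 -> K1 `<=` J1 ->
  open K2 -> K2 !=set0 -> K2 `<=` J2 ->
  (forall s, K1 s -> S1 (g1 s)) -> (forall t, K2 t -> S2 (g2 t)) ->
  locally_listed J1 J2 g1 g2.
Proof. by move=> *; exists K1, K2, S1, S2; split=> //; left. Qed.

Lemma locally_listed_sym J1 J2 g1 g2 :
  locally_listed J1 J2 g1 g2 -> locally_listed J2 J1 g2 g1.
Proof.
move=> [K1 [K2 [S1 [S2 [H1 H2 L H]]]]]; exists K2, K1, S1, S2; split=> //.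
by case: H => -[? ?]; [right|left].
Qed.

Lemma locally_listed_sub J1 J2 J1' J2' g1 g2 : J1 `<=` J1' -> J2 `<=` J2' ->
  locally_listed J1 J2 g1 g2 -> locally_listed J1' J2' g1 g2.
Proof.
move=> s1 s2 [K1 [K2 [S1 [S2 [[? ? k1] [? ? k2] L H]]]]].
exists K1, K2, S1, S2; split=> //; split=> //.
  exact: subset_trans s1.
exact: subset_trans s2.
Qed.

Lemma pos_diag_quadratic_eq0 (m x y : R) :
  0 < m -> m * x ^+ 2 + y ^+ 2 = 0 -> x = 0.
Proof.
move=> m0 E; have : m * x ^+ 2 <= 0 by have := sqr_ge0 y; lra.
by rewrite pmulr_rle0 // => x0; apply/eqP; rewrite -sqrf_eq0 eq_le x0 sqr_ge0.
Qed.

Lemma matching_case U c J1 J2 g1 g2 (x y u z : R -> R) (m a b : R) : rotation U ->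
  open J1 -> J1 !=set0 -> open J2 -> J2 !=set0 ->
  continuous_on J2 u -> continuous_on J2 z ->
  nonconstant_on J1 x -> nonconstant_on J2 u ->
  (forall s, J1 s -> g1 s = motion U c (vec3 (x s) (y s) 0)) ->
  (forall t, J2 t -> g2 t = motion U c (vec3 (u t) 0 (z t))) ->
  0 < m -> m != 1 ->
  (forall s, J1 s -> m * x s ^+ 2 + y s ^+ 2 = a) ->
  (forall t, J2 t -> m / (m - 1) * u t ^+ 2 + z t ^+ 2 = b) ->
  locally_listed J1 J2 g1 g2.
Proof.
move=> rU oJ1 J10 oJ2 J20 cu cz [s1 [s2 [Js1 Js2 x12]]]
  [t1 [t2 [Jt1 Jt2 u12]]] g1E g2E m0 m1 aE bE.
have a0 : 0 < a.
  rewrite lt_neqAle; apply/andP; split; last first.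
    by rewrite -(aE _ Js1) addr_ge0 ?sqr_ge0 // mulr_ge0 ?sqr_ge0 ?(ltW m0).
  apply: contra_neq x12 => a0.
  have x0 s : J1 s -> x s = 0.
    by move=> Js; apply: (pos_diag_quadratic_eq0 m0 (y := y s)); rewrite aE.
  by rewrite !x0.
have [b0|b0] := eqVneq b 0; last first.
  have [S1 [S2 [mS H1 H2]]] := matching_standard c rU a0 m0 b0 m1.
  apply: (@locally_listed_intro _ _ J1 J2 _ _ S1 S2) => //
    [|s Js|t Jt]; first by do 4 right; left.
    by rewrite g1E //; apply/H1/aE.
  by rewrite g2E //; apply/H2/bE.
have {}m1 : m < 1.
  rewrite lt_neqAle m1 leNgt; apply: contraNN u12 => m1'.
  have mm0 : 0 < m / (m - 1) by rewrite divr_gt0 // subr_gt0.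
  have u0 t : J2 t -> u t = 0.
    by move=> Jt; apply: (pos_diag_quadratic_eq0 mm0 (y := z t)); rewrite bE.
  by rewrite !u0.
have m1' : 1 - m != 0 by rewrite subr_eq0 gt_eqF.
have m1'' : m - 1 != 0 by rewrite subr_eq0 lt_eqF.
pose k := Num.sqrt (m / (1 - m)).
have kE : k ^+ 2 = m / (1 - m).
  by rewrite sqr_sqrtr // divr_ge0 ?subr_ge0 // ltW.
have [|t Jt|K2 [e [oK2 K20 K2J e1 zE]]] :=
    sqr_eq_open oJ2 J20 cz (g := fun t => k * u t).
- by move=> t Jt; apply: cvgM; [exact: cvg_cst|exact: cu].
- rewrite exprMn kE; have := bE _ Jt; rewrite b0 => /eqP.
  by rewrite addrC addr_eq0 => /eqP ->; field; rewrite m1' m1''.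
have [||S1 [S2 [mS H1 H2]]] := cylinder_standard (k := e * k) c rU a0 m0.
- by rewrite lt_eqF.
- by rewrite exprMn e1 mul1r.
apply/locally_listed_sym/(@locally_listed_intro _ _ K2 J1 _ _ S1 S2) => //.
- by right; right; left.
- by move=> t Kt; rewrite g2E; [rewrite zE // mulrA; exact: H1|exact: K2J].
by move=> s Js; rewrite g1E //; apply/H2/aE.
Qed.

Lemma conic_case U c J1 J2 g1 g2 (x y u z : R -> R) (mu kap c1 c2 : R) :
  rotation U ->
  open J1 -> J1 !=set0 -> open J2 -> J2 !=set0 ->
  continuous_on J1 x -> continuous_on J1 y ->
  continuous_on J2 u -> continuous_on J2 z ->
  nonconstant_on J1 x -> nonconstant_on J2 u ->
  (forall s, J1 s -> g1 s = motion U c (vec3 (x s) (y s) 0)) ->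
  (forall t, J2 t -> g2 t = motion U c (vec3 (u t) 0 (z t))) ->
  mu != 0 ->
  (forall s, J1 s -> x s ^+ 2 + y s ^+ 2 = 2 * kap * x s + mu * x s ^+ 2 + c1) ->
  (forall t, J2 t ->
    mu * (u t ^+ 2 + z t ^+ 2) = - (2 * kap * u t) + u t ^+ 2 + c2) ->
  locally_listed J1 J2 g1 g2.
Proof.
move=> rU oJ1 J10 oJ2 J20 cx cy cu cz nx nu g1E g2E mu0 E1 E2.
have [mu1|mu1] := eqVneq mu 1.
  have y2 s : J1 s -> y s ^+ 2 = 2 * kap * x s + c1.
    by move=> /E1; rewrite mu1; lra.
  have z2 t : J2 t -> z t ^+ 2 = - (2 * kap * u t) + c2.
    by move=> /E2; rewrite mu1; lra.
  have [k0|k0] := eqVneq kap 0.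
    have sqrtE J (f : R -> R) d : (forall s, J s -> f s ^+ 2 = d) ->
        forall s, J s -> f s ^+ 2 = (cst (Num.sqrt d) s) ^+ 2.
      by move=> fd s Js; rewrite /cst fd // sqr_sqrtr // -(fd _ Js) sqr_ge0.
    have [||K1 [e1 [oK1 K10 K1J _ yE]]] :=
        sqr_eq_open oJ1 J10 cy (g := cst (Num.sqrt c1)).
    - by move=> s _; exact: cvg_cst.
    - by apply: sqrtE => // s /y2 ->; rewrite k0; ring.
    have [||K2 [e2 [oK2 K20 K2J _ zE]]] :=
        sqr_eq_open oJ2 J20 cz (g := cst (Num.sqrt c2)).
    - by move=> t _; exact: cvg_cst.
    - by apply: sqrtE => // t /z2 ->; rewrite k0; ring.
    have [S1 [S2 [pS H1 H2]]] := parallel_standard c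
      (e1 * Num.sqrt c1) 0 0 (e2 * Num.sqrt c2) rU.
    apply: (@locally_listed_intro _ _ K1 K2 _ _ S1 S2) => //
      [|s Ks|t Kt]; first by right; left.
      by rewrite g1E ?yE //; exact: K1J.
    by rewrite g2E ?zE //; exact: K2J.
  have [S1 [S2 [pS H1 H2]]] :=
    CPO_standard c (- c1 / (2 * kap)) (c2 / (2 * kap)) rU k0.
  apply: (@locally_listed_intro _ _ J1 J2 _ _ S1 S2) => //
    [|s Js|t Jt]; first by right; right; right; left.
    by rewrite g1E //; apply: H1; rewrite y2 //; field.
  by rewrite g2E //; apply: H2; rewrite z2 //; field.
pose m := 1 - mu; pose h := kap / m.
have m0 : m != 0 by rewrite subr_eq0 eq_sym.
have m1 : m - 1 != 0 by rewrite /m addrAC subrr add0r oppr_eq0.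
pose x' s := x s - h; pose u' t := u t - h.
pose c' := vec3 h 0 0 *m U + c.
have g1E' s : J1 s -> g1 s = motion U c' (vec3 (x' s) (y s) 0).
  by move=> Js; rewrite g1E // motion_shift vec3D subrK !addr0.
have g2E' t : J2 t -> g2 t = motion U c' (vec3 (u' t) 0 (z t)).
  by move=> Jt; rewrite g2E // motion_shift vec3D subrK !addr0.
have cx' : continuous_on J1 x'.
  by move=> s Js; apply: cvgB; [exact: cx|exact: cvg_cst].
have cu' : continuous_on J2 u'.
  by move=> s Js; apply: cvgB; [exact: cu|exact: cvg_cst].
have nx' : nonconstant_on J1 x'.
  case: nx => s1 [s2 [? ? ?]]; exists s1, s2; split=> //.
  by rewrite (inj_eq (addIr _)).
have nu' : nonconstant_on J2 u'.
  case: nu => s1 [s2 [? ? ?]]; exists s1, s2; split=> //.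
  by rewrite (inj_eq (addIr _)).
have E1' s : J1 s -> m * x' s ^+ 2 + y s ^+ 2 = c1 + kap ^+ 2 / m.
  move=> Js; have -> : y s ^+ 2 = 2 * kap * x s + (mu - 1) * x s ^+ 2 + c1.
    by have := E1 _ Js; lra.
  have -> : mu = 1 - m by rewrite /m; ring.
  by rewrite /x' /h; field.
have E2' t : J2 t -> m / (m - 1) * u' t ^+ 2 + z t ^+ 2 =
    c2 / mu + kap ^+ 2 / (m * (m - 1)).
  move=> Jt; have -> : z t ^+ 2 =
      (- (2 * kap * u t) + u t ^+ 2 + c2) / mu - u t ^+ 2.
    by rewrite -E2 //; field.
  have muE : mu = 1 - m by rewrite /m; ring.
  rewrite /u' /h muE; field.
  by rewrite m0 m1 -muE mu0.
have [mgt0|mlt0] := ltP 0 m.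
  apply: (matching_case rU _ _ _ _ cu' cz nx' nu' g1E' g2E' mgt0 _ E1' E2') => //.
  by rewrite -subr_eq0.
apply: locally_listed_sym.
have {}mlt0 : m < 0 by rewrite lt_neqAle m0.
have mm0 : 0 < m / (m - 1) by rewrite nmulr_rgt0 // invr_lt0; lra.
apply: (@matching_case (turn *m U) c' J2 J1 g2 g1 u' z x' (fun s => - y s)
  (m / (m - 1)) (c2 / mu + kap ^+ 2 / (m * (m - 1))) (c1 + kap ^+ 2 / m)) => //.
- exact: rotation_mul turn_rotation rU.
- by move=> s Js; apply: cvgN; exact: cy.
- by move=> t Jt; rewrite motion_turn oppr0; exact: g2E'.
- by move=> s Js; rewrite motion_turn opprK; exact: g1E'.
- apply/eqP => mE; have : m = m - 1 by rewrite -[LHS](divfK m1) mE mul1r.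
  by lra.
move=> s Js; rewrite sqrrN -(E1' _ Js); congr (_ * _ + _); field.
by rewrite m1; apply/eqP; lra.
Qed.

Lemma separated_case U c J1 J2 g1 g2 (x dx y dy u du z dz : R -> R)
    (phi1 phi2 phi3 : R -> R) : rotation U ->
  open_interval J1 -> open_interval J2 ->
  (forall s, J1 s -> is_derive s (1 : R) x (dx s)) ->
  (forall s, J1 s -> is_derive s (1 : R) y (dy s)) ->
  (forall t, J2 t -> is_derive t (1 : R) u (du t)) ->
  (forall t, J2 t -> is_derive t (1 : R) z (dz t)) ->
  (forall s, J1 s -> dx s != 0) -> (forall t, J2 t -> du t != 0) ->
  (forall s, J1 s -> derivable phi1 s 1) ->
  (forall t, J2 t -> derivable phi2 t 1) ->
  (forall s t, J1 s -> J2 t -> derivable phi3 (phi1 s + phi2 t) 1) ->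
  (forall s, J1 s -> g1 s = motion U c (vec3 (x s) (y s) 0)) ->
  (forall t, J2 t -> g2 t = motion U c (vec3 (u t) 0 (z t))) ->
  (forall s t, J1 s -> J2 t ->
    distance_function g1 g2 s t = phi3 (phi1 s + phi2 t)) ->
  locally_listed J1 J2 g1 g2.
Proof.
move=> rU [oJ1 iJ1 J10] [oJ2 iJ2 J20] Dx Dy Du Dz dx0 du0 D1 D2 D3 g1E g2E E.
have nx : nonconstant_on J1 x.
  case: J10 => s Js; have [r Jr rs] := open_neq_derive oJ1 Js (Dx _ Js) (dx0 _ Js).
  by exists r, s.
have nu : nonconstant_on J2 u.
  case: J20 => s Js; have [r Jr rs] := open_neq_derive oJ2 Js (Du _ Js) (du0 _ Js).
  by exists r, s.
have cont J f df : (forall s, J s -> is_derive s (1 : R) f (df s)) ->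
    continuous_on J f.
  by move=> Df s Js; exact: is_derive_continuous (Df _ Js).
pose P s := x s ^+ 2 + y s ^+ 2; pose Q t := u t ^+ 2 + z t ^+ 2.
pose dP s := 2 * x s * dx s + 2 * y s * dy s.
pose dQ t := 2 * u t * du t + 2 * z t * dz t.
have DP s : J1 s -> is_derive s (1 : R) P (dP s).
  move=> Js; have ? := Dx _ Js; have ? := Dy _ Js.
  by apply: is_derive_eq; rewrite /dP /GRing.scale /=; ring.
have DQ t : J2 t -> is_derive t (1 : R) Q (dQ t).
  move=> Jt; have ? := Du _ Jt; have ? := Dz _ Jt.
  by apply: is_derive_eq; rewrite /dQ /GRing.scale /=; ring.
have E' s t : J1 s -> J2 t ->
    P s + Q t - 2 * (x s * u t) = phi3 (phi1 s + phi2 t).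
  move=> Js Jt; rewrite -E // /distance_function /sqdist g1E // g2E //.
  rewrite motionB (dot_rotation _ _ rU) vec3N vec3D dot_vec3 /P /Q; ring.
have [al [be [ga [de [H1 H2]]]]] := separated_derivatives oJ1 oJ2 J10 J20
  Dx DP Du DQ dx0 du0 D1 D2 D3 E'.
have [s0 Js0] := J10; have [t0 Jt0] := J20.
have [de0|de0] := eqVneq de 0.
  have ga0 : ga != 0 by have [] := H1 _ Js0; rewrite de0 mul0r addr0.
  have be0 : be != 0 by have [] := H2 _ Jt0; rewrite de0 mul0r addr0 oppr_eq0.
  have [|c1 E1] := @integrate_affine R J1 x dx P dP al be ga iJ1 J10 Dx DP.
    by move=> s Js; have [_] := H1 _ Js; rewrite de0 mul0r addr0.
  have [|c2 E2] := @integrate_affine R J2 u du Q dQ al (- ga) (- be) iJ2 J20 Du DQ.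
    by move=> t Jt; have [_] := H2 _ Jt; rewrite de0 mul0r addr0 mulNr.
  apply: (@conic_case U c J1 J2 g1 g2 x y u z (be / ga) (al / ga) (c1 / ga)
    (- c2 / ga)) => //; try exact: cont.
  - by rewrite mulf_neq0 ?invr_eq0.
  - move=> s Js; apply: (mulfI ga0); rewrite -/(P s) E1 //; field.
    exact: ga0.
  - move=> t Jt; have Q2 := E2 _ Jt; rewrite -/(Q t) -[Q t]opprK.
    have -> : be / ga * - - Q t = - (- be * Q t) / ga by ring.
    by rewrite Q2; field.
pose A := 2 * (al / de - be / de * (ga / de)).
have [|c1 E1] := @integrate_homography R J1 x dx P dP
    (al / de) (be / de) (ga / de) iJ1 J10 Dx DP.
  move=> s Js; have [n0 H] := H1 _ Js.
  have e : ga / de + x s = (ga + de * x s) / de by field.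
  rewrite e mulf_neq0 ?invr_eq0 //; split=> //.
  by rewrite mulrA H; field.
have [|c2 E2] := @integrate_homography R J2 u du Q dQ
    (al / de) (- (ga / de)) (- (be / de)) iJ2 J20 Du DQ.
  move=> t Jt; have [n0 H] := H2 _ Jt.
  have e : - (be / de) + u t = (- be + de * u t) / de by field.
  rewrite e mulf_neq0 ?invr_eq0 //; split=> //.
  by rewrite mulrA H; field.
have [S1 [S2 [mS L1 L2]]] := log_circles_standard
  (vec3 (- (ga / de)) 0 0 *m U + c) A (be / de + ga / de)
  (c1 + (be / de) ^+ 2) (c2 + (ga / de) ^+ 2) rU.
apply: (@locally_listed_intro _ _ J1 J2 _ _ S1 S2) => //
    [|s Js|t Jt]; first by do 5 right.
  have [n0 _] := H1 _ Js.
  rewrite g1E // -[x s](addrK (ga / de)).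
  have := L1 (x s + ga / de) (y s); rewrite motion_shift vec3D !addr0; apply.
    have -> : x s + ga / de = (ga + de * x s) / de by field.
    by rewrite mulf_neq0 ?invr_eq0.
  have -> : y s ^+ 2 = P s - x s ^+ 2 by rewrite /P; ring.
  by rewrite E1 // /A; ring.
have [n0 _] := H2 _ Jt.
rewrite g2E // -[u t](addrK (ga / de)).
have := L2 (u t + ga / de) (z t); rewrite motion_shift vec3D !addr0; apply.
  rewrite (inj_eq (addIr _)) -subr_eq0.
  have -> : u t - be / de = (- be + de * u t) / de by field.
  by rewrite mulf_neq0 ?invr_eq0.
have -> : z t ^+ 2 = Q t - u t ^+ 2 by rewrite /Q; ring.
have -> : u t + ga / de - (be / de + ga / de) = u t + - (be / de) by ring.
by rewrite E2 // /A; ring.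
Qed.

End LocalListing.

Section Frame.
Context {R : realType}.
Local Notation E3 := 'rV[R]_3.
Implicit Types (U M : 'M[R]_3) (c v w p n q : E3) (J : set R) (g : R -> E3).

Lemma is_derive_affine_coord g M c j (s : R) : derivable g s 1 ->
  is_derive s (1 : R) (fun r => ((g r - c) *m M) 0 j)
    ((g^`()%classic s *m M) 0 j).
Proof.
move=> dg; have /derivable_mxP dgij := dg.
have D i : is_derive s (1 : R) (fun r => g r 0 i) (g^`()%classic s 0 i).
  by rewrite derive1E derive_mx // mxE; exact/derivableP/dgij.
have -> : (fun r => ((g r - c) *m M) 0 j) = fun r =>
    (g r 0 0 - c 0 0) * M 0 j + (g r 0 1 - c 0 1) * M 1 j
    + (g r 0 2 - c 0 2) * M 2 j.
  apply/funext => r; rewrite mxE !big_ord_recl big_ord0 !mxE addr0 addrA.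
  by congr ((g r _ _ - c _ _) * M _ _ + (g r _ _ - c _ _) * M _ _ +
    (g r _ _ - c _ _) * M _ _); exact/val_inj.
have -> : (g^`()%classic s *m M) 0 j =
    g^`()%classic s 0 0 * M 0 j + g^`()%classic s 0 1 * M 1 j
    + g^`()%classic s 0 2 * M 2 j.
  rewrite mxE !big_ord_recl big_ord0 addr0 addrA.
  by congr (g^`()%classic s _ _ * M _ _ + g^`()%classic s _ _ * M _ _ +
    g^`()%classic s _ _ * M _ _); exact/val_inj.
have ? := D 0; have ? := D 1; have ? := D 2.
by apply: is_derive_eq; rewrite /GRing.scale /=; ring.
Qed.

Lemma smooth_affine_coord J g M c j : smooth_on J g ->
  (forall s, J s -> is_derive s (1 : R) (fun r => ((g r - c) *m M) 0 j)
    ((g^`()%classic s *m M) 0 j)) /\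
  continuous_on J (fun s => (g^`()%classic s *m M) 0 j).
Proof.
move=> sg; split=> s Js.
  exact: is_derive_affine_coord (sg 0%N s Js).
have := is_derive_affine_coord M 0 j (sg 1%N s Js).
rewrite (_ : (fun r => _) = fun r => (g^`()%classic r *m M) 0 j).
  exact: is_derive_continuous.
by apply/funext => r; rewrite subr0.
Qed.

Lemma dot_mulmx v w U : dot v (w *m U) = dot (v *m U^T) w.
Proof. by rewrite /dot trmx_mul mulmxA. Qed.

Lemma motion_inv U c q : rotation U -> q = motion U c ((q - c) *m U^T).
Proof.
move=> /rotation_tr[]; rewrite trmxK => UU _.
by rewrite /motion -mulmxA UU mulmx1 subrK.
Qed.

Lemma dot_gt0 v : v != 0 -> 0 < dot v v.
Proof.
move=> v0; have d0 : 0 <= dot v v by rewrite dotE -!expr2 !addr_ge0 ?sqr_ge0.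
rewrite lt_neqAle d0 andbT; apply: contra_neq v0 => /esym/eqP.
rewrite dotE -!expr2 !paddr_eq0 ?addr_ge0 ?sqr_ge0 // !sqrf_eq0 => /andP[/andP[]].
move=> /eqP v0 /eqP v1 /eqP v2.
by rewrite (vec3_coords v) v0 v1 v2; apply/eqP; rewrite vec3_eq0 eqxx.
Qed.

Lemma perpendicular_frame p1 n1 p2 n2 : n1 != 0 -> n2 != 0 -> dot n1 n2 = 0 ->
  exists U c, [/\ rotation U,
    forall q, plane p1 n1 q -> ((q - c) *m U^T) 0 2 = 0 &
    forall q, plane p2 n2 q -> ((q - c) *m U^T) 0 1 = 0].
Proof.
move=> n10 n20 n12.
have d1 := dot_gt0 n10; have d2 := dot_gt0 n20.
pose a := (Num.sqrt (dot n1 n1))^-1; pose b := (Num.sqrt (dot n2 n2))^-1.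
have aE : a ^+ 2 * dot n1 n1 = 1.
  by rewrite exprVn sqr_sqrtr ?ltW // mulVf // gt_eqF.
have bE : b ^+ 2 * dot n2 n2 = 1.
  by rewrite exprVn sqr_sqrtr ?ltW // mulVf // gt_eqF.
have dotZ k l v w : dot (k *: v) (l *: w) = k * l * dot v w.
  by rewrite !dotE !mxE; ring.
have dotB v w n : dot (v - w) n = dot v n - dot w n.
  by rewrite !dotE !mxE; ring.
pose e3 := a *: n1; pose e2 := b *: n2.
pose e1 := vec3 (e2 0 1 * e3 0 2 - e2 0 2 * e3 0 1)
  (e2 0 2 * e3 0 0 - e2 0 0 * e3 0 2) (e2 0 0 * e3 0 1 - e2 0 1 * e3 0 0).
have e33 : dot e3 e3 = 1 by rewrite dotZ -aE expr2.
have e22 : dot e2 e2 = 1 by rewrite dotZ -bE expr2.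
have dotC v w : dot v w = dot w v by rewrite !dotE; ring.
have e23 : dot e2 e3 = 0 by rewrite dotZ dotC n12 mulr0.
have e12 : dot e1 e2 = 0 by rewrite dotE !mxE /=; ring.
have e13 : dot e1 e3 = 0 by rewrite dotE !mxE /=; ring.
(* Lagrange's identity *)
have e11 : dot e1 e1 = 1.
  transitivity (dot e2 e2 * dot e3 e3 - dot e2 e3 ^+ 2).
    by rewrite !dotE /e1 ![vec3 _ _ _ _ _]mxE /=; ring.
  by rewrite e22 e33 e23; ring.
pose c := (dot p1 n1 / dot n1 n1) *: n1 + (dot p2 n2 / dot n2 n2) *: n2.
have cE n k l : dot (k *: n1 + l *: n2) n = k * dot n1 n + l * dot n2 n.
  by rewrite !dotE !mxE; ring.
have coordE v j : (v *m (mat3 e1 e2 e3)^T) 0 j = dot v [:: e1; e2; e3]`_j.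
  by rewrite /dot !mxE; apply: eq_bigr => k _; rewrite !mxE.
exists (mat3 e1 e2 e3), c; split.
- apply: mat3_rotation => //.
  rewrite -e11 [RHS]dotE ![e1 _ _]mxE /=; ring.
- move=> q; rewrite /plane /= dotB => /eqP; rewrite subr_eq0 => /eqP qE.
  rewrite coordE /= -[q - c]scale1r dotZ dotB qE cE (dotC n2 n1) n12.
  by rewrite mulr0 addr0 divfK ?gt_eqF // subrr mulr0.
move=> q; rewrite /plane /= dotB => /eqP; rewrite subr_eq0 => /eqP qE.
rewrite coordE /= -[q - c]scale1r dotZ dotB qE cE n12.
by rewrite mulr0 add0r divfK ?gt_eqF // subrr mulr0.
Qed.

Lemma line_case U c J1 J2 g1 g2 (x0 : R) (y : R -> R) (S2 : set E3) :
  rotation U -> open J1 -> J1 !=set0 -> open J2 -> J2 !=set0 -> curve S2 ->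
  (forall s, J1 s -> g1 s = motion U c (vec3 x0 (y s) 0)) ->
  (forall q, S2 q -> exists a b, q = motion U c (vec3 a 0 b)) ->
  (forall t, J2 t -> S2 (g2 t)) ->
  locally_listed J1 J2 g1 g2.
Proof.
move=> rU oJ1 J10 oJ2 J20 cS2 g1E S2E g2S.
apply: (@locally_listed_intro _ _ _ J1 J2 _ _
  (line (motion U c (vec3 x0 0 0)) (vec3 0 1 0 *m U)) S2) => // [|s Js].
  left; exists (motion U c (vec3 x0 0 0)), (vec3 0 1 0 *m U), c; split=> //.
    by rewrite rotation_eq0 // vec3_eq0 oner_eq0 andbF.
  move=> q /S2E[a [b ->]]; rewrite /plane /= /motion addrK dot_rotation //.
  by rewrite dot_vec3; ring.
exists (y s); rewrite g1E // /motion scalemxAl addrAC -mulmxDl vec3Z vec3D.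
by congr (vec3 _ _ _ *m _ + _); ring.
Qed.

End Frame.

Theorem theorem6p1 (R : realType) (A1 A2 : set 'rV[R]_3)
    (gamma1 gamma2 : R -> 'rV[R]_3)
    (hA1 : parameterization gamma1 A1) (hA2 : parameterization gamma2 A2)
    (hplanes : in_perpendicular_planes A1 A2)
    (hspecial : special_form `]0, 1[ `]0, 1[ (distance_function gamma1 gamma2)) :
  exists A1' A2' : set 'rV[R]_3,
    [/\ arc_open gamma1 A1' /\ A1' !=set0,
        arc_open gamma2 A2' /\ A2' !=set0 &
        exists S1 S2 : set 'rV[R]_3, listed_pair S1 S2 /\
          ((A1' `<=` S1 /\ A2' `<=` S2) \/ (A1' `<=` S2 /\ A2' `<=` S1))].
Proof.
suff [K1 [K2 [S1 [S2 [[oK1 K10 K1I] [oK2 K20 K2I] L H]]]]] :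
    locally_listed `]0, 1[ `]0, 1[ gamma1 gamma2.
  exists (gamma1 @` K1), (gamma2 @` K2); split.
  - by split; [exists K1|exact: image_nonempty].
  - by split; [exists K2|exact: image_nonempty].
  exists S1, S2; split=> //.
  by case: H => -[H1 H2]; [left|right]; split=> _ [r Kr <-];
    [exact: H1|exact: H2|exact: H1|exact: H2].
have [I1 [I2 [I3 [phi1 [phi2 [phi3 [[oI1 oI2 _] [sI1 sI2] [s1 s2 s3] E]]]]]]] :=
  hspecial.
apply: (locally_listed_sub sI1 sI2).
have [p1 [n1 [p2 [n2 [n10 n20 n12 A1p A2p]]]]] := hplanes.
have [U [c [rU z1 y2]]] := perpendicular_frame p1 p2 n10 n20 n12.
have [sg1 [fg1 _ _]] := hA1; have [sg2 [fg2 _ _]] := hA2.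
pose X1 s := (gamma1 s - c) *m U^T; pose X2 t := (gamma2 t - c) *m U^T.
have A1E q : A1 q -> exists a b, q = motion U c (vec3 a b 0).
  move=> /A1p /z1 z0; exists (((q - c) *m U^T) 0 0), (((q - c) *m U^T) 0 1).
  by rewrite [LHS](motion_inv c _ rU) [X in motion _ _ X]vec3_coords z0.
have A2E q : A2 q -> exists a b, q = motion U c (vec3 a 0 b).
  move=> /A2p /y2 y0; exists (((q - c) *m U^T) 0 0), (((q - c) *m U^T) 0 2).
  by rewrite [LHS](motion_inv c _ rU) [X in motion _ _ X]vec3_coords y0.
have A1g s : I1 s -> A1 (gamma1 s) by move=> /sI1 /fg1.
have A2g t : I2 t -> A2 (gamma2 t) by move=> /sI2 /fg2.
have g1E s : I1 s -> gamma1 s = motion U c (vec3 (X1 s 0 0) (X1 s 0 1) 0).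
  move=> /A1g /A1p /z1 z0; rewrite [LHS](motion_inv c _ rU).
  by rewrite [X in motion _ _ X]vec3_coords z0.
have g2E t : I2 t -> gamma2 t = motion U c (vec3 (X2 t 0 0) 0 (X2 t 0 2)).
  move=> /A2g /A2p /y2 y0; rewrite [LHS](motion_inv c _ rU).
  by rewrite [X in motion _ _ X]vec3_coords y0.
pose dX1 j s := (gamma1^`()%classic s *m U^T) 0 j.
pose dX2 j t := (gamma2^`()%classic t *m U^T) 0 j.
have D1 j s : I1 s -> is_derive s (1 : R) (fun r => X1 r 0 j) (dX1 j s).
  by move=> /sI1; apply: (smooth_affine_coord U^T c j sg1).1.
have D2 j t : I2 t -> is_derive t (1 : R) (fun r => X2 r 0 j) (dX2 j t).
  by move=> /sI2; apply: (smooth_affine_coord U^T c j sg2).1.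
have [x0|/existsNP[s /not_implyP[Is /eqP dxs]]] :=
    pselect (forall s, I1 s -> dX1 0 s = 0).
  have [oJ1 iI1 [s Is]] := oI1; have [oJ2 _ I20] := oI2.
  apply: (@line_case R U c I1 I2 gamma1 gamma2 (X1 s 0 0) (fun s => X1 s 0 1) A2)
    => //; [by exists s|by right; exists gamma2|].
  move=> r Ir; rewrite g1E //; congr (motion _ _ (vec3 _ _ _)).
  apply: (@derive0_interval_cst R I1 (fun r => X1 r 0 0)) => // q Iq.
  by rewrite -(x0 _ Iq); exact: D1.
have [u0|/existsNP[t /not_implyP[It /eqP dut]]] :=
    pselect (forall t, I2 t -> dX2 0 t = 0).
  have [oJ1 _ I10] := oI1; have [oJ2 iI2 [t It]] := oI2.
  apply/locally_listed_sym.
  apply: (@line_case R (turn *m U) c I2 I1 gamma2 gamma1 (X2 t 0 0)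
    (fun t => X2 t 0 2) A1) => //.
  - exact: rotation_mul turn_rotation rU.
  - by exists t.
  - by right; exists gamma1.
  - move=> r Ir; rewrite g2E // motion_turn oppr0.
    congr (motion _ _ (vec3 _ _ _)).
    apply: (@derive0_interval_cst R I2 (fun r => X2 r 0 0)) => // q Iq.
    by rewrite -(u0 _ Iq); exact: D2.
  - move=> q /A1E[a [b ->]]; exists a, (- b).
    by rewrite motion_turn opprK.
have [oJ1 _ _] := oI1; have [oJ2 _ _] := oI2.
have [||J1 [iJ1 J1I dx0]] := @open_neq0 R I1 (dX1 0) oJ1 _ s Is.
- by move=> r /sI1; apply: (smooth_affine_coord U^T c 0 sg1).2.
- exact: dxs.
have [||J2 [iJ2 J2I du0]] := @open_neq0 R I2 (dX2 0) oJ2 _ t It.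
- by move=> r /sI2; apply: (smooth_affine_coord U^T c 0 sg2).2.
- exact: dut.
apply: (locally_listed_sub J1I J2I).
apply: (@separated_case R U c J1 J2 gamma1 gamma2
  (fun s => X1 s 0 0) (dX1 0) (fun s => X1 s 0 1) (dX1 1)
  (fun t => X2 t 0 0) (dX2 0) (fun t => X2 t 0 2) (dX2 2) phi1 phi2 phi3) => //.
- by move=> r /J1I; exact: D1.
- by move=> r /J1I; exact: D1.
- by move=> r /J2I; exact: D2.
- by move=> r /J2I; exact: D2.
- by move=> r /J1I; exact: (s1 0%N).
- by move=> r /J2I; exact: (s2 0%N).
- by move=> r r' /J1I Ir /J2I Ir'; apply: (s3 0%N); have [] := E _ _ Ir Ir'.
- by move=> r /J1I; exact: g1E.
- by move=> r /J2I; exact: g2E.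
- by move=> r r' /J1I Ir /J2I Ir'; have [] := E _ _ Ir Ir'.
Qed.
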